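(* Let $\mathbf A \in \mathcal{MID}$. Then the following are equivalent: (a) $\mathbf A \models x \land x' \approx 0$; (b) $\mathbf{A}$ is a Boolean algebra.
   Context: An implicator groupoid is an algebra $\mathbf A = \langle A, \to, 0 \rangle$, with $\to$ binary and $0$ a constant, which, writing $x' := x \to 0$, satisfies the identities (I) $(x \to y) \to z \approx [(z' \to x) \to (y \to z)']'$ and (I$_0$) $0'' \approx 0$. Put $x \land y := (x \to y')'$. $\mathcal{MID}$ is the variety of implicator groupoids satisfying $x \land x \approx x$. Following the paper, an implicator groupoid is called a De Morgan algebra if it satisfies $(x \to y) \to x \approx x$, and a Boolean algebra if it is a De Morgan algebra and satisfies $x \to x \approx 0'$. *)

(* Defs.v *)
Declare Scope implicator_scope.
Delimit Scope implicator_scope with imp.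

(* The axioms are spelled out with [imp u zero] for the derived negation u'. *)
Record implicator_groupoid : Type := ImplicatorGroupoid {
  carrier :> Type;
  imp : carrier -> carrier -> carrier;
  zero : carrier;
  imp_I : forall x y z : carrier,
    imp (imp x y) z =
      imp (imp (imp (imp z zero) x) (imp (imp y z) zero)) zero;
  imp_I0 : imp (imp zero zero) zero = zero
}.

Arguments imp {_} _ _.
Arguments zero {_}.

Definition neg {A : implicator_groupoid} (x : A) : A := imp x zero.
Definition meet {A : implicator_groupoid} (x y : A) : A := neg (imp x (neg y)).

Notation "x ~> y" := (imp x y) (at level 55, right associativity) :
  implicator_scope.
Notation "x ^~" := (neg x) (at level 2, left associativity, format "x ^~") :
  implicator_scope.
Notation "x & y" := (meet x y) (at level 40, left associativity) :
  implicator_scope.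
Notation "0" := zero : implicator_scope.

Local Open Scope implicator_scope.

Definition in_MID (A : implicator_groupoid) : Prop :=
  forall x : A, x & x = x.

Definition de_morgan_algebra (A : implicator_groupoid) : Prop :=
  forall x y : A, (x ~> y) ~> x = x.

Definition boolean_algebra (A : implicator_groupoid) : Prop :=
  de_morgan_algebra A /\ forall x : A, x ~> x = 0^~.

(* Main.v *)
Require Import Defs.

(** Idempotence of the meet says [(x ~> x^~)^~ = x], and already forces the
    negation to be an involution ([neg_involutive]).  The reason is that [imp_I]
    with [z = 0] gives two rewriting rules under a negation:
    [x^~^~ = (0^~ ~> x)^~^~], and [(x ~> w)^~] depends on [w] only through
    [w^~^~].  Idempotence writes every [y] as [w^~^~] with [w = y^~ ~> y], so
    the second rule, together with [0^~ ~> 0^~ = 0^~], turns [(0^~ ~> w)^~]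
    into [(0^~ ~> y)^~]; negating and applying the first rule to [w] and to [y]
    yields [y = w^~^~ = y^~^~].

    Once negation is an involution, [x & x^~] is [(x ~> x)^~], so (a) amounts to
    [x ~> x = 0^~]; this settles the implication from (b) to (a).  For the
    converse, feeding [x ~> x = 0^~] into [imp_I] yields classical laws of
    implication: [x^~ ~> y] is the disjunction [(x ~> y) ~> y], it is symmetric
    in [x] and [y], and consequently [x ~> (y ~> x) = 0^~].  The last law, read
    through [(x^~ ~> z) ~> x = z ~> x], becomes the Peirce identity
    [(x ~> y) ~> x = x], which defines De Morgan algebras. *)

Local Open Scope implicator_scope.

Lemma neg_neg_zero_imp (A : implicator_groupoid) (x : A) :
  (0^~ ~> x)^~^~ = x^~^~.
Proof.
  unfold neg. rewrite (imp_I A x 0 0), imp_I0. reflexivity.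
Qed.

(** Idempotence for [u = x^~ ~> x]: by [imp_I], [(x ~> x^~) ~> x] is [u & u],
    which equals [u]; and idempotence for [x ~> x^~], whose negation is [x],
    reads [((x ~> x^~) ~> x)^~ = x ~> x^~]. *)
Lemma neg_imp_neg_self (A : implicator_groupoid) (hA : in_MID A) (x : A) :
  (x^~ ~> x)^~ = x ~> x^~.
Proof.
  assert (hu : (x ~> x^~) ~> x = x^~ ~> x).
  { rewrite imp_I. exact (hA (x^~ ~> x)). }
  rewrite <- hu. transitivity ((x ~> x^~) & (x ~> x^~)); [ | apply hA].
  unfold meet at 1. change ((x ~> x^~)^~) with (x & x). rewrite (hA x).
  reflexivity.
Qed.

Lemma neg_zero_imp_neg_zero (A : implicator_groupoid) (hA : in_MID A) :
  (0^~ ~> 0^~ : A) = 0^~.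
Proof.
  assert (h0 : (0 ~> 0^~ : A) = 0^~).
  { rewrite <- (neg_imp_neg_self A hA). unfold neg. rewrite imp_I0.
    reflexivity. }
  transitivity ((0^~ : A)^~^~); unfold neg in *.
  - rewrite (imp_I A 0 0 (0 ~> 0)), h0, imp_I0. rewrite imp_I0. reflexivity.
  - rewrite imp_I0. reflexivity.
Qed.

Lemma neg_involutive (A : implicator_groupoid) (hA : in_MID A) (y : A) :
  y^~^~ = y.
Proof.
  assert (hw : (y^~ ~> y)^~^~ = y).
  { rewrite neg_imp_neg_self by exact hA. exact (hA y). }
  assert (hz : (0^~ ~> (y^~ ~> y))^~ = (0^~ ~> y)^~).
  { unfold neg at 1. rewrite imp_I.
    change (((0^~ ~> 0^~) ~> (y^~ ~> y)^~^~)^~ = (0^~ ~> y)^~).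
    rewrite hw, neg_zero_imp_neg_zero by exact hA. reflexivity. }
  transitivity ((y^~ ~> y)^~^~); [ | exact hw].
  rewrite <- (neg_neg_zero_imp A (y^~ ~> y)), hz, neg_neg_zero_imp.
  reflexivity.
Qed.

Lemma neg_zero_imp (A : implicator_groupoid) (hA : in_MID A) (x : A) :
  0^~ ~> x = x.
Proof.
  rewrite <- (neg_involutive A hA (0^~ ~> x)), neg_neg_zero_imp.
  apply neg_involutive, hA.
Qed.

Lemma imp_neg_imp_absorb (A : implicator_groupoid) (hA : in_MID A)
    (hone : forall x : A, x ~> x = 0^~) (x z : A) :
  (x^~ ~> z) ~> x = z ~> x.
Proof.
  rewrite imp_I. change (((x^~ ~> x^~) ~> (z ~> x)^~)^~ = z ~> x).
  rewrite hone, neg_zero_imp by exact hA. apply neg_involutive, hA.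
Qed.

Lemma zero_imp (A : implicator_groupoid) (hA : in_MID A)
    (hone : forall x : A, x ~> x = 0^~) (x : A) :
  0 ~> x = 0^~.
Proof.
  rewrite <- (imp_neg_imp_absorb A hA hone x 0).
  change (x^~^~ ~> x = 0^~). rewrite neg_involutive by exact hA. apply hone.
Qed.

Lemma imp_imp_right (A : implicator_groupoid) (hA : in_MID A)
    (hone : forall x : A, x ~> x = 0^~) (x y : A) :
  (x ~> y) ~> y = y^~ ~> x.
Proof.
  rewrite imp_I. change (((y^~ ~> x) ~> (y ~> y)^~)^~ = y^~ ~> x).
  rewrite hone, (neg_involutive A hA 0). apply (neg_involutive A hA).
Qed.

(** The instance [y = 0] of [imp_I]: since [0 ~> y] is [0^~], the second factor
    of the meet disappears. *)
Lemma neg_imp_comm (A : implicator_groupoid) (hA : in_MID A)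
    (hone : forall x : A, x ~> x = 0^~) (x y : A) :
  x^~ ~> y = y^~ ~> x.
Proof.
  unfold neg at 1. rewrite imp_I.
  change (((y^~ ~> x) ~> (0 ~> y)^~)^~ = y^~ ~> x).
  rewrite zero_imp, (neg_involutive A hA 0) by assumption.
  apply (neg_involutive A hA).
Qed.

(** With [t = y ~> x], the disjunction of [x] and [t] is [t] itself, that is,
    [x] lies below [t]; writing [x ~> t] as the disjunction of [x^~] and [t]
    then reduces it to [t ~> t]. *)
Lemma imp_weakening (A : implicator_groupoid) (hA : in_MID A)
    (hone : forall x : A, x ~> x = 0^~) (x y : A) :
  x ~> (y ~> x) = 0^~.
Proof.
  assert (ht : x^~ ~> (y ~> x) = y ~> x).
  { rewrite <- imp_imp_right by assumption.
    rewrite (imp_imp_right A hA hone y x).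
    apply imp_neg_imp_absorb; assumption. }
  transitivity (x^~^~ ~> (y ~> x)).
  { rewrite neg_involutive by exact hA. reflexivity. }
  rewrite neg_imp_comm, <- imp_imp_right by assumption.
  rewrite ht. apply hone.
Qed.

(** Contraposition turns [x ~> y] into [z = y^~ ~> x^~], for which weakening
    gives [x^~ ~> z = 0^~]; hence [z ~> x = (x^~ ~> z) ~> x = 0^~ ~> x = x]. *)
Lemma imp_peirce (A : implicator_groupoid) (hA : in_MID A)
    (hone : forall x : A, x ~> x = 0^~) : de_morgan_algebra A.
Proof.
  intros x y. transitivity ((x^~^~ ~> y) ~> x).
  { rewrite neg_involutive by exact hA. reflexivity. }
  rewrite (neg_imp_comm A hA hone (x^~) y).
  rewrite <- (imp_neg_imp_absorb A hA hone), imp_weakening by assumption.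
  apply neg_zero_imp, hA.
Qed.

Theorem theorem3p1 (A : implicator_groupoid) (hA : in_MID A) :
  (forall x : A, x & x^~ = 0) <-> boolean_algebra A.
Proof.
  split.
  - intro h.
    assert (hone : forall x : A, x ~> x = 0^~).
    { intro x. specialize (h x). unfold meet in h.
      rewrite (neg_involutive A hA x) in h.
      rewrite <- h. symmetry. apply (neg_involutive A hA). }
    exact (conj (imp_peirce A hA hone) hone).
  - intros [_ hone] x. unfold meet.
    rewrite (neg_involutive A hA x), hone. apply (neg_involutive A hA).
Qed.
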